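(* Let $G$ be a connected graph of order $n\ge3$ with $m$ edges and let $\frac12\le\alpha<1$. Then \[E^{A_\alpha}(G)\le2(n-1)+2(\eta-1)(\alpha n-1)-\frac{4\alpha\eta m}{n},\] with equality if and only if $G\cong K_n$.
   Context: $A_\alpha(G)=\alpha D(G)+(1-\alpha)A(G)$, where $A(G)$ is the adjacency matrix and $D(G)$ the diagonal degree matrix of $G$; its eigenvalues are $\rho_1\ge\dots\ge\rho_n$. $E^{A_\alpha}(G)=\sum_{i=1}^n\left|\rho_i-\frac{2\alpha m}{n}\right|$. $\eta=\eta(G)$ is the number of eigenvalues $\rho_i$ of $A_\alpha(G)$ with $\rho_i\ge\frac{2\alpha m}{n}$. $K_n$ is the complete graph. *)

(* Defs.v *)
From mathcomp Require Import all_boot all_order all_algebra.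
From mathcomp Require Import polyrcf complex.
From mathcomp Require Import reals.

Set Implicit Arguments.
Unset Strict Implicit.
Unset Printing Implicit Defensive.

Import Order.TTheory GRing.Theory Num.Theory.
Local Open Scope ring_scope.

Record sgraph := SGraph {
  vertex :> finType;
  adj : rel vertex;
  adj_sym : symmetric adj;
  adj_irrefl : irreflexive adj }.

Section Graph.
Variable G : sgraph.

Definition gorder := #|G|.

Definition edges : {set {set G}} :=
  [set X | [exists x, exists y, (X == [set x; y]) && adj x y]].

Definition degree (x : G) := #|[set y | adj x y]|.

Definition connected_graph := forall x y : G, connect (@adj G) x y.

End Graph.

Definition isomorphic (G H : sgraph) :=
  exists2 f : G -> H, bijective f & forall x y, adj (f x) (f y) = adj x y.

Section Complete.
Variable n : nat.

Definition complete_adj : rel 'I_n := [rel x y | x != y].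

Fact complete_sym : symmetric complete_adj.
Proof. by move=> x y; rewrite /complete_adj /= eq_sym. Qed.

Fact complete_irrefl : irreflexive complete_adj.
Proof. by move=> x; rewrite /complete_adj /= eqxx. Qed.

Definition complete_graph := SGraph complete_sym complete_irrefl.

End Complete.

Section Spectrum.
Variable R : rcfType.

(* [rootsR p] lists the distinct real roots of [p] in increasing order and
   [mup x p] is the multiplicity of [x] in [p], so this is the weakly decreasing
   sequence of the real eigenvalues, repeated according to their multiplicity as
   roots of the characteristic polynomial.  For symmetric [A] these are all
   the eigenvalues: see [char_poly_eigenvalues] and [size_eigenvalues]. *)
Definition eigenvalues n (A : 'M[R]_n) : seq R :=
  rev (flatten [seq nseq (mup x (char_poly A)) x | x <- rootsR (char_poly A)]).

Lemma perm_eigenvalues n (A : 'M[R]_n) (s : seq R) :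
  char_poly A = \prod_(x <- s) ('X - x%:P) -> perm_eq (eigenvalues A) s.
Proof.
move=> As; have p0 : char_poly A != 0 by rewrite monic_neq0 ?char_poly_monic.
have ur : uniq (rootsR (char_poly A)).
  by apply: (sorted_uniq lt_trans (@ltxx _ _)); apply: sorted_roots.
apply/allP => x _ /=; apply/eqP; rewrite /eigenvalues count_rev count_flatten.
rewrite -map_comp sumnE big_map.
transitivity (mup x (char_poly A)); last by rewrite As mu_prod_XsubC.
have rE : (x \in rootsR (char_poly A)) = root (char_poly A) x.
  by rewrite -(roots_on_rootsR p0) in_itv.
have [xr|xNr] := boolP (x \in rootsR (char_poly A)).
  rewrite (bigD1_seq x) //= count_nseq /= eqxx mul1n big1 ?addn0 // => y yx.
  by rewrite count_nseq /= (negPf yx).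
rewrite mupNroot -?rE // big_seq big1 // => y yr; rewrite /= count_nseq /=.
by case: eqP yr xNr => // -> ->.
Qed.

Lemma mem_eigenvalues n (A : 'M[R]_n) x : (x \in eigenvalues A) = eigenvalue A x.
Proof.
have p0 : char_poly A != 0 by rewrite monic_neq0 ?char_poly_monic.
rewrite eigenvalue_root_char /eigenvalues mem_rev.
rewrite -dvdp_XsubCl XsubC_dvd //; apply/flattenP/idP => [[t /mapP[y _ ->]]|mx].
  by rewrite mem_nseq => /andP[m0 /eqP ->].
exists (nseq (mup x (char_poly A)) x); last by rewrite mem_nseq mx eqxx.
apply/map_f; rewrite -(roots_on_rootsR p0) in_itv /=.
by rewrite -dvdp_XsubCl XsubC_dvd.
Qed.

Lemma char_poly_symmetric n (A : 'M[R]_n) :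
  A^T = A -> exists s, char_poly A = \prod_(x <- s) ('X - x%:P).
Proof.
move=> sA; pose f : {rmorphism R -> R[i]} := real_complex R.
pose B := map_mx f A.
have Bherm : B \is hermsymmx.
  apply: realsym_hermsym.
    apply/is_hermitianmxP; rewrite expr0 scale1r map_mx_id //.
    by rewrite /B map_trmx sA.
  apply/mxOverP => i j; rewrite mxE; apply/complex_realP; by exists (A i j).
have /hermitian_normalmx/orthomx_spectralP := Bherm.
have := hermitian_spectral_diag_real Bherm.
have := spectral_unit B.
move: (spectralmx B) (spectral_diag B) => P d Pu /mxOverP dr BE.
pose e i := complex.Re (d 0 i).
have eE i : f (e i) = d 0 i by rewrite /f /= /e RRe_real.
exists [seq e i | i <- index_enum 'I_n]; rewrite big_map.
apply: (map_poly_inj f); rewrite map_char_poly -/B BE rmorph_prod /=.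
have -> : char_poly (invmx P *m diag_mx d *m P) = char_poly (diag_mx d).
  rewrite /char_poly /char_poly_mx !map_mxM.
  have PP : map_mx polyC (invmx P) *m map_mx polyC P = 1%:M.
    by rewrite -map_mxM mulVmx // map_mx1.
  set Q := map_mx polyC (invmx P) in PP *; set P' := map_mx polyC P in PP *.
  have -> : 'X%:M - Q *m map_mx polyC (diag_mx d) *m P' =
            Q *m ('X%:M - map_mx polyC (diag_mx d)) *m P'.
    by rewrite mulmxBr mulmxBl mul_mx_scalar -scalemxAl PP scalemx1.
  by rewrite !det_mulmx mulrAC -det_mulmx PP det1 mul1r.
rewrite char_poly_trig ?diag_mx_is_trig //.
apply: eq_bigr => i _; rewrite mxE eqxx mulr1n rmorphB /= map_polyX map_polyC /=.
by rewrite eE.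
Qed.

Lemma char_poly_eigenvalues n (A : 'M[R]_n) :
  A^T = A -> char_poly A = \prod_(x <- eigenvalues A) ('X - x%:P).
Proof.
by move=> /char_poly_symmetric [s As]; rewrite As; apply/esym/perm_big/perm_eigenvalues.
Qed.

Lemma size_eigenvalues n (A : 'M[R]_n) : A^T = A -> size (eigenvalues A) = n.
Proof.
move=> /char_poly_eigenvalues /(congr1 (fun p : {poly R} => size p)).
by rewrite size_char_poly size_prod_XsubC => -[].
Qed.

End Spectrum.

Section AlphaMatrix.
Variables (R : rcfType) (G : sgraph).

(* Rows and columns are indexed by the vertices through [enum_val]. *)
Definition adjacency_mx : 'M[R]_(gorder G) :=
  \matrix_(i, j) (adj (enum_val i) (enum_val j))%:R.

Definition degree_mx : 'M[R]_(gorder G) :=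
  diag_mx (\row_i (degree (enum_val i))%:R).

Definition Aalpha (alpha : R) : 'M[R]_(gorder G) :=
  alpha *: degree_mx + (1 - alpha) *: adjacency_mx.

Definition mean_Aalpha (alpha : R) : R :=
  2 * alpha * #|edges G|%:R / (gorder G)%:R.

Definition energy_Aalpha (alpha : R) : R :=
  \sum_(rho <- eigenvalues (Aalpha alpha)) `|rho - mean_Aalpha alpha|.

Definition eta (alpha : R) : nat :=
  count (fun rho => mean_Aalpha alpha <= rho) (eigenvalues (Aalpha alpha)).

Lemma Aalpha_sym (alpha : R) : (Aalpha alpha)^T = Aalpha alpha.
Proof.
rewrite /Aalpha linearD /= !linearZ /= tr_diag_mx; congr (_ + _ *: _).
by apply/matrixP => i j; rewrite !mxE adj_sym.
Qed.

End AlphaMatrix.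

(* Main.v *)
(** Write [A_alpha(G)] as [(alpha n - 1) I + (1 - alpha) J - C], where [C] is
    [A_alpha] of the complement graph, positive semidefinite since
    [alpha >= 1/2].  An eigenvalue with unit eigenvector [v] is then
    [(alpha n - 1) + (1 - alpha) <v, 1>^2 - <v, C v>].  The energy is twice the
    sum of [rho_i - 2 alpha m / n] over the [eta] selected eigenvalues, so by
    Parseval ([sum_i <v_i, 1>^2 = n]) the gap in the inequality is exactly
    [2 (1 - alpha)] times the sum of [<v_i, 1>^2] over the unselected [i], plus
    twice the sum of [<v_i, C v_i>] over the selected ones.  If it vanishes, the
    all-one vector lies in the span of the selected [v_i], each of which
    satisfies [v_j + v_k = 0] for nonadjacent [j <> k]; as [1 + 1 <> 0] there is
    no such pair. *)
Require Import Defs.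
From mathcomp Require Import all_boot all_order all_algebra.
From mathcomp Require Import complex ring lra.
From mathcomp Require Import reals.

Set Implicit Arguments.
Unset Strict Implicit.
Unset Printing Implicit Defensive.

Import Order.TTheory GRing.Theory Num.Theory.
Local Open Scope ring_scope.

(** * Spectral decomposition of a real symmetric matrix *)

Lemma char_poly_invmx_mul (F : fieldType) (n : nat) (P D : 'M[F]_n) :
  P \in unitmx -> char_poly (invmx P *m D *m P) = char_poly D.
Proof.
move=> Pu.
have PP : map_mx polyC (invmx P) *m map_mx polyC P = 1%:M.
  by rewrite -map_mxM mulVmx // map_mx1.
transitivity
    (\det (map_mx polyC (invmx P) *m char_poly_mx D *m map_mx polyC P)).
  rewrite /char_poly; congr (\det _).
  rewrite /char_poly_mx mulmxBr mulmxBl mul_mx_scalar -scalemxAl PP scalemx1.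
  by rewrite !map_mxM.
by rewrite !det_mulmx mulrAC -det_mulmx PP det1 mul1r.
Qed.

Section SpectralFrame.
Variable R : rcfType.

Lemma Re_sum (I : Type) (r : seq I) (P : pred I) (F : I -> R[i]) :
  complex.Re (\sum_(i <- r | P i) F i) = \sum_(i <- r | P i) complex.Re (F i).
Proof. by apply: (big_morph (@complex.Re R)) => // -[? ?] [? ?]. Qed.

Lemma Im_sum (I : Type) (r : seq I) (P : pred I) (F : I -> R[i]) :
  complex.Im (\sum_(i <- r | P i) F i) = \sum_(i <- r | P i) complex.Im (F i).
Proof. by apply: (big_morph (@complex.Im R)) => // -[? ?] [? ?]. Qed.

Lemma Re_mul_conj (z w : R[i]) :
  complex.Re (z * Num.conj w)
  = complex.Re z * complex.Re w + complex.Im z * complex.Im w.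
Proof. by case: z w => [a b] [c d]; rewrite /= mulrN opprK. Qed.

(* The rows of [X] and [Y] are the real and imaginary parts of a unitary
   eigenbasis of the complexification of [A], so they are real eigenvectors,
   and together they form a Parseval frame. *)
Lemma symmetric_spectral_frame n (A : 'M[R]_n) : A^T = A ->
  exists (X Y : 'M[R]_n) (e : 'I_n -> R),
  [/\ perm_eq (eigenvalues A) [seq e i | i <- enum 'I_n],
      forall i j, (X *m A) i j = e i * X i j /\ (Y *m A) i j = e i * Y i j,
      forall i, \sum_j (X i j ^+ 2 + Y i j ^+ 2) = 1
    & forall j k, \sum_i (X i j * X i k + Y i j * Y i k) = (j == k)%:R].
Proof.
move=> sA; pose f : {rmorphism R -> R[i]} := real_complex R.
pose B := map_mx f A.
have Bherm : B \is hermsymmx.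
  apply: realsym_hermsym.
    by apply/is_hermitianmxP; rewrite expr0 scale1r map_mx_id // /B map_trmx sA.
  by apply/mxOverP => i j; rewrite mxE; apply/complex_realP; exists (A i j).
have /hermitian_normalmx/orthomx_spectralP := Bherm.
have := hermitian_spectral_diag_real Bherm.
have := spectral_unitarymx B; have := spectral_unit B.
move: (spectralmx B) (spectral_diag B) => P d Pu Punit /mxOverP dr BE.
pose e i := complex.Re (d 0 i).
have eE i : f (e i) = d 0 i by rewrite /f /= /e RRe_real.
have PB : P *m B = diag_mx d *m P by rewrite BE !mulmxA mulmxV // mul1mx.
exists (map_mx (@complex.Re R) P), (map_mx (@complex.Im R) P), e; split.
- apply: perm_eigenvalues; rewrite big_map big_enum /=.
  apply: (map_poly_inj f); rewrite map_char_poly -/B BE char_poly_invmx_mul //.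
  rewrite char_poly_trig ?diag_mx_is_trig // rmorph_prod.
  apply: eq_bigr => i _; rewrite mxE eqxx mulr1n rmorphB /= map_polyX.
  by rewrite map_polyC /= eE.
- move=> i j; have := congr1 (fun M : 'M_n => M i j) PB.
  rewrite mul_diag_mx !mxE -eE => H; split.
    have := congr1 (@complex.Re R) H; rewrite Re_sum.
    have -> : complex.Re (f (e i) * P i j) = e i * complex.Re (P i j).
      by case: (P i j) => a b /=; rewrite mul0r subr0.
    move=> <-; apply: eq_bigr => k _; rewrite !mxE.
    by case: (P i k) => a b /=; rewrite mulr0 subr0.
  have := congr1 (@complex.Im R) H; rewrite Im_sum.
  have -> : complex.Im (f (e i) * P i j) = e i * complex.Im (P i j).
    by case: (P i j) => a b /=; rewrite mul0r addr0.
  move=> <-; apply: eq_bigr => k _; rewrite !mxE.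
  by case: (P i k) => a b /=; rewrite mulr0 add0r.
- move=> i.
  have /unitarymxP/(congr1 (fun M : 'M_n => complex.Re (M i i))) := Punit.
  rewrite !mxE eqxx Re_sum => H; rewrite -[RHS]H; apply: eq_bigr => j _.
  by rewrite !mxE Re_mul_conj !expr2.
- move=> j k.
  (* Orthonormality of the columns, [P^* P = 1]: the real part of its [(k, j)] entry is the required
     sum. *)
  have := mulVmx Pu; rewrite invmx_unitary //.
  move/(congr1 (fun M : 'M_n => complex.Re (M k j))).
  rewrite !mxE Re_sum => H.
  have -> : (j == k)%:R = complex.Re ((k == j)%:R : R[i]).
    by rewrite eq_sym; case: (k == j).
  rewrite -H; apply: eq_bigr => i _.
  by rewrite !mxE [X in _ = complex.Re X]mulrC Re_mul_conj.
Qed.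

End SpectralFrame.

(** * Trace and absolute deviations of the eigenvalues *)

(** Up to sign, both sides are the coefficient of degree [n - 1] in the characteristic polynomial;
    dimension 0 has no such coefficient and is treated apart. *)
Lemma sum_eigenvalues (R : rcfType) n (A : 'M[R]_n) :
  A^T = A -> \sum_(x <- eigenvalues A) x = \tr A.
Proof.
move=> sA; have sz := size_eigenvalues sA.
case: n => [|n] in A sA sz *.
  by rewrite (size0nil sz) big_nil /mxtrace big_ord0.
apply: oppr_inj; rewrite -char_poly_trace // char_poly_eigenvalues //.
by have := @coefPn_prod_XsubC R (eigenvalues A); rewrite sz => ->.
Qed.

(** The deviations [d] from the mean sum to zero, and [|d| + d] is [2 d] when [d >= 0] and zero
    otherwise. *)
Lemma sum_dist_mean (R : realDomainType) (mu : R) (s : seq R) :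
  \sum_(x <- s) x = mu *+ size s ->
  \sum_(x <- s) `|x - mu| = 2 * \sum_(x <- s | mu <= x) (x - mu).
Proof.
move=> smu; have s0 : \sum_(x <- s) (x - mu) = 0.
  by rewrite sumrB smu big_const_seq count_predT -Monoid.iteropE subrr.
rewrite [in RHS]big_mkcond -[RHS]subr0 -[X in _ - X]s0 mulr_sumr -sumrB.
by apply: eq_bigr => x _; case: (lerP mu x) => _; ring.
Qed.

(** * Degrees, trace and the quadratic form of [Aalpha] *)

Section AlphaForm.
Variables (R : rcfType) (G : sgraph).
Local Notation N := (gorder G).
Local Notation "j ~~> k" := (adj (enum_val j) (enum_val k)) (at level 40).

Lemma natr_degree (j : 'I_N) :
  (degree (enum_val j))%:R = \sum_(k < N) (j ~~> k)%:R :> R.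
Proof.
rewrite /degree -sum1_card natr_sum (reindex (@enum_val _ G)) /=; last first.
  exact/onW_bij/enum_val_bij.
by rewrite big_mkcond /=; apply: eq_bigr => k _; rewrite inE; case: adj.
Qed.

(** Handshake lemma: ordered adjacent pairs are counted by first vertex, then by underlying edge. *)
Lemma sum_degree : (\sum_(x : G) degree x = 2 * #|edges G|)%N.
Proof.
transitivity (\sum_(p : G * G | adj p.1 p.2) 1)%N.
  rewrite -(pair_big_dep xpredT (@adj G) (fun _ _ => 1%N)) /=.
  apply: eq_bigr => x _; rewrite /degree -sum1_card.
  by apply: eq_bigl => y; rewrite inE.
rewrite (partition_big (fun p => [set p.1; p.2]) (mem (edges G))) /=; last first.
  move=> [x y] /= xy; rewrite inE; apply/existsP; exists x.
  by apply/existsP; exists y; rewrite eqxx.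
rewrite mulnC -sum_nat_const; apply: eq_bigr => X.
rewrite inE => /existsP[x /existsP[y /andP[/eqP-> xy]]].
have xNy : x != y by apply: contraTneq xy => ->; rewrite adj_irrefl.
(* The fibre over the edge [{x, y}] consists of [(x, y)] and [(y, x)], which differ because there
   are no loops. *)
have := cards2 (x, y) (y, x); rewrite xpair_eqE negb_and xNy /= => <-.
rewrite -sum1_card; apply: eq_bigl => -[u v]; rewrite !inE !xpair_eqE /=.
apply/andP/orP => [[uv /eqP E]|[]/andP[/eqP-> /eqP->]]; last 2 first.
- by rewrite xy eqxx.
- by rewrite adj_sym xy setUC eqxx.
have uNv : u != v by apply: contraTneq uv => ->; rewrite adj_irrefl.
have : u \in [set x; y] by rewrite -E set21.
have : v \in [set x; y] by rewrite -E set22.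
rewrite !inE => /orP[]/eqP Ev /orP[]/eqP Eu; move: uNv;
  rewrite Ev Eu ?eqxx // => _; by [left|right].
Qed.

Variable alpha : R.

Lemma AalphaE (j k : 'I_N) : Aalpha G alpha j k =
  alpha * (degree (enum_val j))%:R * (j == k)%:R + (1 - alpha) * (j ~~> k)%:R.
Proof. by rewrite !mxE -mulrA; congr (_ * _ + _); rewrite mulr_natr. Qed.

Lemma Aalpha_row_sum (j : 'I_N) :
  \sum_k Aalpha G alpha j k = (degree (enum_val j))%:R.
Proof.
under eq_bigr do rewrite AalphaE.
rewrite big_split /= -!mulr_sumr -natr_degree (bigD1 j) //= eqxx big1 => [|k kj].
  by rewrite mulr1n; ring.
by rewrite eq_sym (negPf kj).
Qed.

Lemma sum_degreeR :
  \sum_(j < N) (degree (enum_val j))%:R = 2 * #|edges G|%:R :> R.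
Proof.
rewrite -natrM -sum_degree natr_sum [RHS](reindex (@enum_val _ G)) //=.
exact/onW_bij/enum_val_bij.
Qed.

Lemma trace_Aalpha : \tr (Aalpha G alpha) = 2 * alpha * #|edges G|%:R.
Proof.
rewrite [2 * alpha]mulrC -mulrA -sum_degreeR mulr_sumr; apply: eq_bigr => j _.
by rewrite AalphaE eqxx adj_irrefl mulr1 mulr0 addr0.
Qed.

(* The quadratic form of [A_alpha] of the complement graph, written so as to be
   manifestly nonnegative when [1/2 <= alpha <= 1]. *)
Definition compl_form (x : 'I_N -> R) : R :=
  \sum_j \sum_(k | (k != j) && ~~ (j ~~> k))
    ((2 * alpha - 1) * (x j ^+ 2 + x k ^+ 2) + (1 - alpha) * (x j + x k) ^+ 2)
      / 2.

Lemma Aalpha_form (x : 'I_N -> R) :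
  \sum_j (\sum_k x k * Aalpha G alpha k j) * x j =
  (alpha * N%:R - 1) * (\sum_j x j ^+ 2) + (1 - alpha) * (\sum_j x j) ^+ 2
  - compl_form x.
Proof.
set Q := \sum_j x j ^+ 2; set S := \sum_j x j.
pose T := \sum_(j < N) \sum_(k < N) (j ~~> k)%:R * x j ^+ 2.
pose U := \sum_(j < N) \sum_(k < N) (j ~~> k)%:R * (x j * x k).
have T' : \sum_(j < N) \sum_(k < N) (j ~~> k)%:R * x k ^+ 2 = T.
  rewrite exchange_big; apply: eq_bigr => j _; apply: eq_bigr => k _.
  by rewrite adj_sym.
have QN : \sum_(j < N) \sum_(k < N) x j ^+ 2 = N%:R * Q.
  under eq_bigr do rewrite sumr_const card_ord -mulr_natl.
  by rewrite -mulr_sumr.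
have QN' : \sum_(j < N) \sum_(k < N) x k ^+ 2 = N%:R * Q.
  by rewrite sumr_const card_ord mulr_natl.
have SS : \sum_j \sum_k x j * x k = S ^+ 2.
  by rewrite expr2 /S mulr_suml; apply: eq_bigr => j _; rewrite mulr_sumr.
have QD : \sum_j \sum_k (k == j)%:R * x k ^+ 2 = Q.
  apply: eq_bigr => j _; rewrite (bigD1 j) //= eqxx mul1r big1 ?addr0 // => k.
  by move=> /negPf->; rewrite mul0r.
have -> : \sum_j (\sum_k x k * Aalpha G alpha k j) * x j
          = alpha * T + (1 - alpha) * U.
  transitivity (\sum_j (alpha * (degree (enum_val j))%:R * x j ^+ 2
                 + (1 - alpha) * \sum_k (j ~~> k)%:R * (x j * x k))).
    apply: eq_bigr => j _.
    under eq_bigr do rewrite AalphaE mulrDr.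
    rewrite big_split /= mulrDl (bigD1 j) //= big1 ?addr0; last first.
      by move=> k /negPf->; rewrite !mulr0.
    rewrite eqxx; congr (_ + _); first by rewrite mulr1n; ring.
    rewrite mulr_suml mulr_sumr; apply: eq_bigr => k _.
    by rewrite adj_sym; ring.
  rewrite big_split /= -mulr_sumr; congr (_ + _); rewrite /T mulr_sumr.
  by apply: eq_bigr => j _; rewrite -mulr_suml -natr_degree mulrA.
have L2 (c : R) F : c * (\sum_(j < N) \sum_(k < N) F j k)
    = \sum_j \sum_k c * F j k.
  by rewrite mulr_sumr; apply: eq_bigr => j _; rewrite mulr_sumr.
(* The summand of [compl_form] equals [alpha / 2 * (x_j^2 + x_k^2) + (1 - alpha) * x_j * x_k]. It is
   summed over all pairs, then the diagonal, where it is [x_j^2], and the adjacent pairs are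
   removed. *)
have -> : compl_form x =
    (1 - alpha) * (\sum_(j < N) \sum_(k < N) x j * x k)
    + alpha / 2 * (\sum_(j < N) \sum_(k < N) x j ^+ 2)
    + alpha / 2 * (\sum_(j < N) \sum_(k < N) x k ^+ 2)
    - \sum_(j < N) \sum_(k < N) (k == j)%:R * x k ^+ 2
    - alpha / 2 * (\sum_(j < N) \sum_(k < N) (j ~~> k)%:R * x j ^+ 2)
    - alpha / 2 * (\sum_(j < N) \sum_(k < N) (j ~~> k)%:R * x k ^+ 2)
    - (1 - alpha) * (\sum_(j < N) \sum_(k < N) (j ~~> k)%:R * (x j * x k)).
  rewrite !L2 -!(sumrB, big_split); apply: eq_bigr => j _.
  rewrite -!(sumrB, big_split) /= big_mkcond; apply: eq_bigr => k _.
  case: (eqVneq k j) => [->|_] /=.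
    by rewrite adj_irrefl mulr1n mulr0n; field.
  by case: (j ~~> k) => /=; rewrite ?mulr1n ?mulr0n; field.
rewrite SS QN QN' QD T' -/T -/U.
by field.
Qed.

Hypothesis halpha : 1 / 2 <= alpha < 1.

Lemma compl_term_ge0 (a b : R) :
  0 <= ((2 * alpha - 1) * (a ^+ 2 + b ^+ 2) + (1 - alpha) * (a + b) ^+ 2) / 2.
Proof.
have /andP[h1 h2] := halpha.
have p : 0 <= 2 * alpha - 1 by lra.
have q : 0 <= 1 - alpha by lra.
by rewrite divr_ge0 // addr_ge0 // mulr_ge0 // ?addr_ge0 ?sqr_ge0.
Qed.

Lemma compl_form_ge0 x : 0 <= compl_form x.
Proof.
by apply: sumr_ge0 => j _; apply: sumr_ge0 => k _; exact: compl_term_ge0.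
Qed.

(** A vanishing sum of nonnegative terms has only zero terms, and in each of them the square
    [(x j + x k) ^+ 2] carries the positive weight [1 - alpha]. *)
Lemma compl_form_eq0 x j k : compl_form x = 0 ->
  k != j -> ~~ (j ~~> k) -> x j + x k = 0.
Proof.
move=> /eqP; rewrite psumr_eq0 => [/allP/(_ j (mem_index_enum _))/=|j0 _];
  last by apply: sumr_ge0 => k0 _; exact: compl_term_ge0.
rewrite psumr_eq0 => [|k0 _]; last exact: compl_term_ge0.
move=> /allP/(_ k (mem_index_enum _))/= + kj jk; rewrite kj jk /= => /eqP.
have /andP[h1 h2] := halpha.
have p : 0 <= (2 * alpha - 1) * (x j ^+ 2 + x k ^+ 2).
  by apply: mulr_ge0; [lra | rewrite addr_ge0 ?sqr_ge0].
have q : 0 <= (1 - alpha) * (x j + x k) ^+ 2.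
  by apply: mulr_ge0; [lra | rewrite sqr_ge0].
move=> H; have /eqP : (1 - alpha) * (x j + x k) ^+ 2 = 0.
  by move: (_ * _) (_ * _) p q H => u v u0 v0 H; lra.
by rewrite mulf_eq0 sqrf_eq0 gt_eqF ?subr_gt0 //= => /eqP.
Qed.

End AlphaForm.

(** * Exact formula for the gap between bound and energy *)

Section Energy.
Variables (R : rcfType) (G : sgraph) (alpha : R).
Hypothesis gorder_gt0 : (0 < gorder G)%N.
Local Notation N := (gorder G).
Local Notation A := (Aalpha G alpha).
Local Notation mu := (mean_Aalpha G alpha).

Definition energy_bound : R :=
  2 * (N%:R - 1) + 2 * ((eta G alpha)%:R - 1) * (alpha * N%:R - 1)
  - 4 * alpha * (eta G alpha)%:R * #|edges G|%:R / N%:R.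

(** [mean_Aalpha] is the trace divided by the order, hence the mean of the eigenvalues. *)
Lemma energy_AalphaE :
  energy_Aalpha G alpha = 2 * \sum_(x <- eigenvalues A | mu <= x) (x - mu).
Proof.
rewrite /energy_Aalpha sum_dist_mean // (sum_eigenvalues _).
  rewrite trace_Aalpha size_eigenvalues ?Aalpha_sym // /mean_Aalpha.
  by rewrite -[RHS]mulr_natr divfK // pnatr_eq0 -lt0n.
exact: Aalpha_sym.
Qed.

Lemma energy_gap_frame (X Y : 'M[R]_N) (e : 'I_N -> R) :
    perm_eq (eigenvalues A) [seq e i | i <- enum 'I_N] ->
    (forall i j, (X *m A) i j = e i * X i j /\ (Y *m A) i j = e i * Y i j) ->
    (forall i, \sum_j (X i j ^+ 2 + Y i j ^+ 2) = 1) ->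
    (forall j k, \sum_i (X i j * X i k + Y i j * Y i k) = (j == k)%:R) ->
  energy_bound - energy_Aalpha G alpha =
  2 * ((1 - alpha) *
         (\sum_(i | ~~ (mu <= e i)) ((\sum_j X i j) ^+ 2 + (\sum_j Y i j) ^+ 2))
       + \sum_(i | mu <= e i) (compl_form alpha (X i) + compl_form alpha (Y i))).
Proof.
move=> pe eig norm1 parseval.
pose t i := (\sum_j X i j) ^+ 2 + (\sum_j Y i j) ^+ 2.
pose q i := compl_form alpha (X i) + compl_form alpha (Y i).
(* The quadratic form is evaluated on the [i]-th rows of [X] and [Y] and added; their squared norms
   total 1. *)
have eE i : e i = (alpha * N%:R - 1) + (1 - alpha) * t i - q i.
  have form (Z : 'M[R]_N) : (forall j, (Z *m A) i j = e i * Z i j) ->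
      e i * (\sum_j Z i j ^+ 2) = (alpha * N%:R - 1) * (\sum_j Z i j ^+ 2)
        + (1 - alpha) * (\sum_j Z i j) ^+ 2 - compl_form alpha (Z i).
    move=> eigZ; rewrite -Aalpha_form mulr_sumr; apply: eq_bigr => j _.
    by have := eigZ j; rewrite mxE => ->; rewrite expr2 mulrA.
  have := form X (fun j => (eig i j).1); have := form Y (fun j => (eig i j).2).
  have := norm1 i; rewrite big_split /= /t /q.
  move: (\sum_j X i j ^+ 2) (\sum_j Y i j ^+ 2) => a b ab1 HY HX.
  rewrite -[e i]mulr1 -{1}ab1 mulrDr HX HY.
  by rewrite -[alpha * N%:R - 1 in RHS]mulr1 -ab1; ring.
(* Parseval for the all-one vector. *)
have tN : \sum_i t i = N%:R.
  transitivity (\sum_i \sum_j \sum_k (X i j * X i k + Y i j * Y i k)).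
    apply: eq_bigr => i _; rewrite /t !expr2 !mulr_suml -big_split /=.
    by apply: eq_bigr => j _; rewrite !mulr_sumr -big_split.
  rewrite exchange_big; transitivity (\sum_(j < N) (1 : R)).
    apply: eq_bigr => j _; rewrite exchange_big /=.
    under eq_bigr do rewrite parseval.
    rewrite (bigD1 j) //= eqxx big1 ?addr0 // => k.
    by rewrite eq_sym => /negPf->.
  by rewrite sumr_const card_ord.
have -> : energy_Aalpha G alpha = 2 * \sum_(i | mu <= e i) (e i - mu).
  by rewrite energy_AalphaE (perm_big _ pe) big_map big_enum_cond.
have etaE : eta G alpha = #|[pred i | mu <= e i]|.
  rewrite /eta (permP pe) count_map -sum1_count big_enum_cond /=.
  by rewrite sum1_card.
(* The bound grants the whole Parseval mass [N] to the selected eigenvalues and drops their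
   [q i]. *)
have -> : energy_bound = 2 * ((1 - alpha) * N%:R +
   \sum_(i | mu <= e i) ((alpha * N%:R - 1) - mu)).
  rewrite sumr_const -etaE -[_ *+ eta _ _]mulr_natr.
  by rewrite /energy_bound /mean_Aalpha; ring.
have -> : \sum_(i | mu <= e i) (e i - mu) =
    \sum_(i | mu <= e i) ((alpha * N%:R - 1) - mu)
    + (1 - alpha) * (\sum_(i | mu <= e i) t i) - \sum_(i | mu <= e i) q i.
  rewrite mulr_sumr -big_split -sumrB; apply: eq_bigr => i _.
  by rewrite eE /=; ring.
rewrite -mulrBr -tN (bigID (fun i => mu <= e i)) /= -/t -/q.
by ring.
Qed.

End Energy.

(** * Inequality and equality case *)

Lemma isomorphic_complete (G : sgraph) :
  isomorphic G (complete_graph (gorder G)) <->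
  (forall x y : G, x != y -> adj x y).
Proof.
split=> [[f fbij fadj] x y xy | Gc].
  by rewrite -fadj /= /complete_adj /= (bij_eq fbij).
exists (@enum_rank G); first exact: enum_rank_bij.
move=> x y; rewrite /= /complete_adj /= (inj_eq enum_rank_inj).
by case: (eqVneq x y) => [->|/Gc->] //; rewrite adj_irrefl.
Qed.

Lemma energy_bound_sharp (R : rcfType) (G : sgraph) (alpha : R) :
  (0 < gorder G)%N -> 1 / 2 <= alpha < 1 ->
  energy_Aalpha G alpha <= energy_bound G alpha
  /\ (energy_Aalpha G alpha = energy_bound G alpha
      <-> isomorphic G (complete_graph (gorder G))).
Proof.
move=> G0 ha; have /andP[a1 a2] := ha.
have a1' : 0 < 1 - alpha by rewrite subr_gt0.
have [X [Y [e [pe eig norm1 parseval]]]] :=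
  symmetric_spectral_frame (Aalpha_sym G alpha).
have := energy_gap_frame G0 pe eig norm1 parseval.
set T := \sum_(i | ~~ _) _; set Q := \sum_(i | _ <= _) _ => gap.
have t_ge0 i : 0 <= (\sum_j X i j) ^+ 2 + (\sum_j Y i j) ^+ 2.
  by rewrite addr_ge0 ?sqr_ge0.
have q_ge0 i : 0 <= compl_form alpha (X i) + compl_form alpha (Y i).
  by rewrite addr_ge0 ?compl_form_ge0.
have T0 : 0 <= (1 - alpha) * T by rewrite mulr_ge0 ?sumr_ge0 // ltW.
have Q0 : 0 <= Q by rewrite sumr_ge0.
split; first by lra.
rewrite isomorphic_complete; split=> [E x y xy | Gc].
  apply: contraT => Nxy.
  have /eqP : (1 - alpha) * T = 0 by lra.
  rewrite mulf_eq0 gt_eqF //= psumr_eq0 // => /allP TE.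
  have /eqP : Q = 0 by lra.
  rewrite psumr_eq0 // => /allP QE.
  pose j : 'I_(gorder G) := enum_rank x; pose k : 'I_(gorder G) := enum_rank y.
  have jk : k != j by rewrite (inj_eq enum_rank_inj) eq_sym.
  have Njk : ~~ adj (enum_val j) (enum_val k) by rewrite !enum_rankK.
  (* The frame expansion of the inner product of the all-one vector with the sum of the unit vectors
     at [j] and [k]. In the [i]-th term, the factors [X i j + X i k] and [Y i j + Y i k] vanish if
     [i] is selected, and the row sums vanish otherwise. *)
  have : \sum_i \sum_l (X i l * (X i j + X i k) + Y i l * (Y i j + Y i k)) = 0.
    rewrite big1 // => i _; rewrite big_split /= -!mulr_suml.
    have [sel|unsel] := boolP (mean_Aalpha G alpha <= e i).
      have /implyP/(_ sel) := QE i (mem_index_enum _).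
      rewrite paddr_eq0 ?compl_form_ge0 // => /andP[/eqP Xi /eqP Yi].
      by rewrite !(@compl_form_eq0 _ _ _ ha _ j k) // !mulr0 addr0.
    have /implyP/(_ unsel) := TE i (mem_index_enum _).
    rewrite paddr_eq0 ?sqr_ge0 // !sqrf_eq0 => /andP[/eqP-> /eqP->].
    by rewrite !mul0r addr0.
  rewrite exchange_big /=.
  (* By Parseval the same inner product is [1 + 1], a contradiction. *)
  have -> : \sum_l \sum_i (X i l * (X i j + X i k) + Y i l * (Y i j + Y i k))
      = \sum_l ((l == j)%:R + (l == k)%:R) :> R.
    apply: eq_bigr => l _; rewrite -!parseval -big_split.
    by apply: eq_bigr => i _ /=; ring.
  have d1 (z : 'I_(gorder G)) : \sum_l (l == z)%:R = 1 :> R.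
    by rewrite (bigD1 z) //= eqxx big1 ?addr0 // => l /negPf->.
  rewrite big_split /= !d1 => /eqP.
  by rewrite -mulr2n pnatr_eq0.
apply/eqP; rewrite eq_sym -subr_eq0 gap.
have cf0 (x : 'I_(gorder G) -> R) : compl_form alpha x = 0.
  rewrite /compl_form big1 // => j _; rewrite big_pred0 // => k.
  case: eqVneq => //= kj; rewrite Gc //.
  by rewrite (inj_eq enum_val_inj) eq_sym.
have -> : Q = 0 by rewrite /Q big1 // => i _; rewrite !cf0 addr0.
have degE (x : G) : degree x = (gorder G).-1.
  rewrite /degree /gorder -(cardsC1 x); apply: eq_card => y.
  rewrite !inE eq_sym; case: eqVneq => [->|/Gc //]; exact: adj_irrefl.
have N0 : (gorder G)%:R != 0 :> R by rewrite pnatr_eq0 -lt0n.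
have muE : mean_Aalpha G alpha = alpha * (gorder G).-1%:R.
  rewrite /mean_Aalpha [2 * alpha]mulrC -(mulrA alpha) -(sum_degreeR R G).
  under eq_bigr do rewrite degE.
  by rewrite sumr_const card_ord -[_%:R *+ _]mulr_natr mulrA mulfK.
(* In the complete graph the all-one vector has eigenvalue [n - 1]. An unselected eigenvalue lies
   below [alpha * (n - 1) <= n - 1], so its eigenvectors are orthogonal to the all-one vector. *)
have -> : T = 0.
  rewrite /T big1 // => i; rewrite -ltNge muE => ei.
  have lt_e : e i < (gorder G).-1%:R.
    apply: (lt_le_trans ei); rewrite ler_piMl //; exact: ltW.
  have row0 (Z : 'M[R]_(gorder G)) :
      (forall j, (Z *m Aalpha G alpha) i j = e i * Z i j) -> \sum_j Z i j = 0.
    move=> eigZ.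
    have : e i * \sum_j Z i j = (gorder G).-1%:R * \sum_j Z i j.
      rewrite !mulr_sumr -(eq_bigr _ (fun j _ => eigZ j)).
      under eq_bigr do rewrite mxE.
      rewrite exchange_big /=; apply: eq_bigr => j _.
      by rewrite -mulr_sumr Aalpha_row_sum degE mulrC.
    move/eqP; rewrite -subr_eq0 -mulrBl mulf_eq0 subr_eq0 lt_eqF //=.
    by move/eqP.
  by rewrite !row0 ?expr0n ?addr0 // => j; case: (eig i j).
by rewrite mulr0 addr0 mulr0.
Qed.

Theorem theorem2p11 (R : realType) (G : sgraph) (n m : nat) (alpha : R)
    (hG : connected_graph G)
    (hn : gorder G = n)
    (hm : #|edges G| = m)
    (hn3 : (3 <= n)%N)
    (halpha : 1 / 2 <= alpha < 1) :
  let h : R := (eta G alpha)%:R in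
  let bound : R :=
    2 * (n%:R - 1) + 2 * (h - 1) * (alpha * n%:R - 1)
      - 4 * alpha * h * m%:R / n%:R in
  energy_Aalpha G alpha <= bound
  /\ (energy_Aalpha G alpha = bound <-> isomorphic G (complete_graph n)).
Proof.
move=> h bound; rewrite /h /bound; subst n m.
by apply: energy_bound_sharp => //; apply: leq_trans hn3.
Qed.
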